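(* Let $I=(v_1,v_2,D)$ be the Herzog-Northcott ideal of $A$ attached to $x_1,x_2,x_3$ and $a,b$. Then there exists an algorithmically specified element $g$ in the radical of $I$ such that $\operatorname{rad}(I)=\operatorname{rad}(v_1,g)$. Moreover, if $x_1,x_2,x_3$ is a regular sequence and $\operatorname{grade}(v_1,v_2)=2$, then this element $g$ lies in $I$.
   Context: $A$ is a commutative Noetherian ring with identity and $x_1,x_2,x_3$ is a sequence of elements of $A$ generating a proper ideal of height $3$. $a=(a_1,a_2,a_3)$ and $b=(b_1,b_2,b_3)$ are triples of positive integers, and $c=a+b=(c_1,c_2,c_3)$. Put $v_1=x_1^{c_1}-x_2^{b_2}x_3^{a_3}$, $v_2=x_2^{c_2}-x_1^{a_1}x_3^{b_3}$, $D=x_3^{c_3}-x_1^{b_1}x_2^{a_2}$; up to sign these are the $2\times 2$ minors of the matrix $\begin{pmatrix} x_1^{a_1} & x_2^{a_2} & x_3^{a_3} \\ x_2^{b_2} & x_3^{b_3} & x_1^{b_1} \end{pmatrix}$. The ideal $I=(v_1,v_2,D)$ is called the Herzog-Northcott (HN) ideal associated to this matrix. The grade of a proper ideal is the maximal length of a regular sequence on $A$ contained in it; $\operatorname{rad}$ denotes the radical of an ideal. *)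

(* Defs.v *)
From mathcomp Require Import all_boot all_order all_algebra ring_quotient.
From mathcomp Require Import boolp classical_sets.

Set Implicit Arguments.
Unset Strict Implicit.
Unset Printing Implicit Defensive.

Import GRing.Theory.
Local Open Scope classical_set_scope.
Local Open Scope ring_scope.

Section CommutativeAlgebra.
Variable A : comNzRingType.
Implicit Types (J P : set A) (s : seq A).

Definition ideal_gen s : set A :=
  [set z | exists c : 'I_(size s) -> A, z = \sum_(i < size s) c i * s`_i].

Definition radical J : set A := [set z | exists n : nat, J (z ^+ n)].

(* [idealr_closed] includes properness. *)
Definition prime_ideal P : Prop :=
  idealr_closed [in P] /\ prime_idealr_closed [in P].

(* Every ideal is finitely generated; [idealr_closed] only covers the proper
   ideals, and the unit ideal is generated by 1. *)
Definition noetherian : Prop :=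
  forall J, idealr_closed [in J] -> exists s, J = ideal_gen s.

(* There is a chain p 0 < p 1 < ... < p n = P of prime ideals. *)
Definition prime_chain_to P (n : nat) : Prop :=
  exists p : nat -> set A,
    [/\ forall i, (i <= n)%N -> prime_ideal (p i),
        forall i, (i < n)%N -> p i `<` p i.+1
      & p n = P].

Definition has_prime_height P (n : nat) : Prop :=
  prime_chain_to P n /\ forall m, prime_chain_to P m -> (m <= n)%N.

(* The height of J is the minimum of the heights of the primes containing J. *)
Definition has_height J (n : nat) : Prop :=
  (exists P, [/\ prime_ideal P, J `<=` P & has_prime_height P n]) /\
  (forall P m, prime_ideal P -> J `<=` P -> has_prime_height P m -> (n <= m)%N).

Definition regular_seq s : Prop :=
  ~ ideal_gen s 1 /\
  forall (i : nat) (z : A), (i < size s)%N ->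
    ideal_gen (take i s) (s`_i * z) -> ideal_gen (take i s) z.

Definition regular_seq_in J s : Prop :=
  regular_seq s /\ (forall z, z \in s -> J z).

Definition has_grade J (n : nat) : Prop :=
  (exists2 s, regular_seq_in J s & size s = n) /\
  (forall s, regular_seq_in J s -> (size s <= n)%N).

End CommutativeAlgebra.

Arguments noetherian A : clear implicits.

Section HerzogNorthcott.
Variables (A : comNzRingType) (x1 x2 x3 : A) (a1 a2 a3 b1 b2 b3 : nat).

Definition hn_v1 : A := x1 ^+ (a1 + b1) - x2 ^+ b2 * x3 ^+ a3.
Definition hn_v2 : A := x2 ^+ (a2 + b2) - x1 ^+ a1 * x3 ^+ b3.
Definition hn_D : A := x3 ^+ (a3 + b3) - x1 ^+ b1 * x2 ^+ a2.

Definition hn_ideal : set A := ideal_gen [:: hn_v1; hn_v2; hn_D].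

(* With c = a + b, expand D ^+ c1 by the binomial theorem; in the k-th term
   write k * b1 = q * c1 + r with r < c1 and replace x1 ^+ (k * b1) by
   x1 ^+ r * (x2 ^+ b2 * x3 ^+ a3) ^+ q, to which it is congruent modulo v1;
   finally cancel the common factor x3 ^+ (b1 * a3).  The last exponent below
   involves no truncation: q >= b1 - (c1 - k) because b1 <= c1. *)
Definition hn_g : A :=
  let c1 := (a1 + b1)%N in
  let c3 := (a3 + b3)%N in
  \sum_(k < c1.+1)
    let q := (k * b1 %/ c1)%N in
    let r := (k * b1 %% c1)%N in
    (-1) ^+ k * 'C(c1, k)%:R
      * x1 ^+ r
      * x2 ^+ (k * a2 + q * b2)
      * x3 ^+ ((c1 - k) * c3 + q * a3 - b1 * a3).

End HerzogNorthcott.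

(* Main.v *)
Require Import Defs.
From mathcomp Require Import all_boot all_order all_algebra ring_quotient.
From mathcomp Require Import boolp classical_sets.
From mathcomp Require Import zify ring.

(** Let m_k be the k-th monomial of g.  Passing from m_k to m_(k+1) replaces a
    factor x3^c3 by x1^b1 x2^a2 when the quotient q does not change, and a
    factor x1^a1 x3^b3 by x2^c2 when q increases by one.  Hence all the m_k are
    congruent modulo (v2, D), and g, an alternating binomial combination of
    them, lies in I.

    Conversely, let J = rad(v1, g).  By construction D^c1 is congruent to
    x3^(b1 a3) g modulo v1, so D is in J.  The two syzygies given by the rows of
    the matrix then put x1 v2 and x3 v2 in J.  Since g is congruent to a power
    of x2, up to sign, modulo x3, also x2 v2 is in J.  So v2^2, hence v2, is in
    J. *)

Set Implicit Arguments.
Unset Strict Implicit.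
Unset Printing Implicit Defensive.

Import GRing.Theory.
Local Open Scope classical_set_scope.
Local Open Scope ring_scope.

(** * Closure properties of ideals and radicals *)

Section Ideals.
Variable A : comNzRingType.
Implicit Types (J K : set A) (s : seq A).

(* Unlike [idealr_closed], this allows the unit ideal. *)
Definition is_ideal J : Prop :=
  [/\ J 0, forall x y, J x -> J y -> J (x + y) & forall c x, J x -> J (c * x)].

Lemma ideal0 J : is_ideal J -> J 0. Proof. by case. Qed.

Lemma idealD J x y : is_ideal J -> J x -> J y -> J (x + y).
Proof. by case=> _ + _; apply. Qed.

Lemma idealM J c x : is_ideal J -> J x -> J (c * x).
Proof. by case=> _ _; apply. Qed.

Lemma idealMr J c x : is_ideal J -> J x -> J (x * c).
Proof. by rewrite mulrC; apply: idealM. Qed.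

Lemma idealN J x : is_ideal J -> J x -> J (- x).
Proof. by move=> idJ Jx; rewrite -mulN1r; apply: idealM. Qed.

Lemma idealB J x y : is_ideal J -> J x -> J y -> J (x - y).
Proof. by move=> idJ Jx Jy; apply: idealD => //; apply: idealN. Qed.

Lemma ideal_sum J (I : finType) (P : pred I) (F : I -> A) :
  is_ideal J -> (forall i, P i -> J (F i)) -> J (\sum_(i | P i) F i).
Proof.
move=> idJ JF; apply: big_ind => //; first exact: ideal0.
by move=> x y; apply: idealD.
Qed.

Lemma ideal_gen_ideal s : is_ideal (ideal_gen s).
Proof.
split.
- by exists (fun=> 0); rewrite big1 // => i _; rewrite mul0r.
- move=> _ _ [c ->] [d ->]; exists (fun i => c i + d i).
  by rewrite -big_split; apply: eq_bigr => i _; rewrite mulrDl.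
- move=> e _ [c ->]; exists (fun i => e * c i).
  by rewrite mulr_sumr; apply: eq_bigr => i _; rewrite mulrA.
Qed.

Lemma mem_ideal_gen s x : x \in s -> ideal_gen s x.
Proof.
move=> xs; have lt_i : (index x s < size s)%N by rewrite index_mem.
exists (fun i => (i == Ordinal lt_i)%:R).
rewrite (bigD1 (Ordinal lt_i)) //= eqxx mul1r nth_index // big1 ?addr0 //.
by move=> i /negPf ->; rewrite mul0r.
Qed.

Lemma ideal_gen_sub J s :
  is_ideal J -> (forall x, x \in s -> J x) -> ideal_gen s `<=` J.
Proof.
move=> idJ Js _ [c ->]; apply: ideal_sum => // i _.
by apply: idealM => //; apply: Js; rewrite mem_nth.
Qed.

Lemma sub_radical J : J `<=` radical J.
Proof. by move=> x Jx; exists 1; rewrite expr1. Qed.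

Lemma radical_ideal J : is_ideal J -> is_ideal (radical J).
Proof.
move=> idJ; split.
- by apply: sub_radical; apply: ideal0.
- move=> x y [m Jx] [n Jy]; exists (m + n)%N.
  rewrite exprDn; apply: ideal_sum => // i _; rewrite -mulr_natr.
  apply: idealMr => //; have [le_ni|lt_in] := leqP n i.
    by rewrite -(subnK le_ni) exprD mulrA; apply: idealM.
  have -> : (m + n - i = (n - i) + m)%N by lia.
  by rewrite exprD mulrAC; apply: idealM.
- by move=> c x [n Jx]; exists n; rewrite exprMn; apply: idealM.
Qed.

Lemma radical_exp J n x : radical J (x ^+ n) -> radical J x.
Proof. by case=> m; rewrite -exprM; exists (n * m)%N. Qed.

(** The power [(x * y) ^+ n.+1] is a multiple of [x ^+ n * y]. This strips the exponents from the
    variables in the syzygies. *)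
Lemma radical_expM J n x y :
  is_ideal J -> radical J (x ^+ n * y) -> radical J (x * y).
Proof.
move=> idJ Jxy; apply: (@radical_exp J n.+1).
have -> : (x * y) ^+ n.+1 = x * y ^+ n * (x ^+ n * y).
  by rewrite exprMn !exprS; ring.
by apply: idealM => //; apply: radical_ideal.
Qed.

Lemma radical_sub J K :
  J `<=` radical K -> radical J `<=` radical K.
Proof. by move=> JK x [n /JK]; apply: radical_exp. Qed.

End Ideals.

Section HerzogNorthcott.
Variables (A : comNzRingType) (x1 x2 x3 : A) (a1 a2 a3 b1 b2 b3 : nat).
Hypotheses (a1_gt0 : (0 < a1)%N) (a2_gt0 : (0 < a2)%N).
Hypothesis (b3_gt0 : (0 < b3)%N).

Local Notation c1 := (a1 + b1)%N.
Local Notation c2 := (a2 + b2)%N.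
Local Notation c3 := (a3 + b3)%N.
Local Notation v1 := (hn_v1 x1 x2 x3 a1 a3 b1 b2).
Local Notation v2 := (hn_v2 x1 x2 x3 a1 a2 b2 b3).
Local Notation D := (hn_D x1 x2 x3 a2 a3 b1 b3).
Local Notation g := (hn_g x1 x2 x3 a1 a2 a3 b1 b2 b3).
Local Notation q k := (k * b1 %/ c1)%N.
Local Notation r k := (k * b1 %% c1)%N.
Local Notation e3 k := ((c1 - k) * c3 + q k * a3 - b1 * a3)%N.

(** * Exponents of the monomials of [g] *)

Definition hn_monomial (k : nat) : A :=
  x1 ^+ r k * x2 ^+ (k * a2 + q k * b2) * x3 ^+ e3 k.

Lemma hn_gE :
  g = \sum_(k < c1.+1) (-1) ^+ k * 'C(c1, k)%:R * hn_monomial k.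
Proof. by apply: eq_bigr => k _; rewrite /hn_monomial !mulrA. Qed.

(** Put j = c1 - k. Over the integers k b1 = b1 c1 - j b1 >= (b1 - j) c1, since b1 <= c1; now divide
    by c1. *)
Lemma hn_quotient_ge k : (k <= c1)%N -> (b1 <= q k + (c1 - k))%N.
Proof.
move=> le_k; have := divn_eq (k * b1) c1; have : (r k < c1)%N.
  by rewrite ltn_mod; lia.
by nia.
Qed.

(** As c3 >= a3, the bound on [q k] shows that the subtraction in [e3 k] is not truncated. *)
Lemma hn_x3_exponentE k :
  (k <= c1)%N -> (e3 k + b1 * a3 = (c1 - k) * c3 + q k * a3)%N.
Proof. by move=> /hn_quotient_ge ?; rewrite subnK //; nia. Qed.

Lemma hn_step_eq k : q k.+1 = q k -> r k.+1 = (r k + b1)%N.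
Proof.
move=> eq_q; have := divn_eq (k.+1 * b1) c1; have := divn_eq (k * b1) c1.
by rewrite eq_q mulSn; lia.
Qed.

(** Adding b1 < c1 to k b1 produces at most one carry; with a carry, [r k + b1 = r k.+1 + c1]. *)
Lemma hn_step_cases k :
  q k.+1 = q k \/ q k.+1 = (q k).+1 /\ r k = (r k.+1 + a1)%N.
Proof.
have := divn_eq (k.+1 * b1) c1; have := divn_eq (k * b1) c1.
have : (r k < c1)%N by rewrite ltn_mod; lia.
have : (r k.+1 < c1)%N by rewrite ltn_mod; lia.
move: (q k) (q k.+1) (r k) (r k.+1) => q0 q1 r0 r1.
rewrite mulSn; move: (k * b1)%N => n lt1 lt0 -> e.
have [->|ne] := eqVneq q1 q0; [by left | right].
have : q1 = q0.+1 by nia.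
by move=> eq1; split => //; move: e; rewrite eq1 mulSn; lia.
Qed.

(** * Membership of [g] in ideals containing [v2] and [D] *)

Lemma hn_monomial_step (J : set A) k :
  is_ideal J -> J v2 -> J D -> (k < c1)%N ->
  J (hn_monomial k.+1 - hn_monomial k).
Proof.
move=> idJ Jv2 JD lt_k.
have eS := hn_x3_exponentE lt_k; have e0 := hn_x3_exponentE (ltnW lt_k).
have ck : (c1 - k = (c1 - k.+1).+1)%N by lia.
rewrite /hn_monomial; case: (hn_step_cases k) => [eq_q|[eq_q eq_r]].
- have -> : e3 k = (e3 k.+1 + c3)%N by move: eS e0; rewrite eq_q ck; lia.
  rewrite (hn_step_eq eq_q) eq_q mulSn.
  set m := x1 ^+ r k * x2 ^+ (k * a2 + q k * b2) * x3 ^+ e3 k.+1.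
  rewrite [X in J X](_ : _ = - m * D); first exact: idealM.
  by rewrite /m /hn_D eq_q !exprD; ring.
(* The exponent loses c3 and the carry returns a3, a net loss of b3. *)
- have -> : e3 k = (e3 k.+1 + b3)%N by move: eS e0; rewrite eq_q ck; lia.
  rewrite eq_r.
  set m := x1 ^+ r k.+1 * x2 ^+ (k * a2 + q k * b2) * x3 ^+ e3 k.+1.
  rewrite [X in J X](_ : _ = m * v2); first exact: idealM.
  have -> : (k.+1 * a2 + q k.+1 * b2 = k * a2 + q k * b2 + c2)%N.
    by rewrite eq_q; lia.
  by rewrite /m /hn_v2 !exprD; ring.
Qed.

Lemma hn_g_mem (J : set A) : is_ideal J -> J v2 -> J D -> J g.
Proof.
move=> idJ Jv2 JD.
have Jm k : (k <= c1)%N -> J (hn_monomial k - hn_monomial 0).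
  elim: k => [|k IHk] lt_k; first by rewrite subrr; apply: ideal0.
  rewrite -[X in J X](subrKA (hn_monomial k)).
  by apply: idealD (hn_monomial_step idJ Jv2 JD lt_k) (IHk (ltnW lt_k)).
(* This is the expansion of (1 - 1)^c1 with c1 > 0. It allows [hn_monomial 0] to be subtracted from
   every monomial of [g]. *)
have sum0 : \sum_(k < c1.+1) (-1) ^+ k * 'C(c1, k)%:R = 0 :> A.
  have := exprBn (1 : A) 1 c1.
  rewrite subrr expr0n addn_eq0 eqn0Ngt a1_gt0 /= => /esym; apply: etrans.
  by apply: eq_bigr => k _; rewrite !expr1n !mulr1 mulr_natr.
have -> : g = \sum_(k < c1.+1) (-1) ^+ k * 'C(c1, k)%:R * hn_monomial k
    - (\sum_(k < c1.+1) (-1) ^+ k * 'C(c1, k)%:R) * hn_monomial 0.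
  by rewrite sum0 mul0r subr0 -hn_gE.
rewrite mulr_suml -sumrB; apply: ideal_sum => // k _.
by rewrite -mulrBr; apply: idealM => //; apply: Jm; rewrite -ltnS.
Qed.

(** * Reductions of [g] modulo [v1] and modulo [x3] *)

Lemma hn_D_expE : exists w, D ^+ c1 = x3 ^+ (b1 * a3) * g + w * v1.
Proof.
suff [w Dw] : ideal_gen [:: v1] (D ^+ c1 - x3 ^+ (b1 * a3) * g).
  exists (w ord0); move: Dw; rewrite big_ord1 /= => <-.
  by rewrite addrC subrK.
have idv1 := ideal_gen_ideal [:: v1].
have Jv1 : ideal_gen [:: v1] v1 by apply: mem_ideal_gen; rewrite inE.
rewrite hn_gE mulr_sumr {1}/hn_D exprBn -sumrB; apply: ideal_sum => // k _.
have lek : (k <= c1)%N by rewrite -ltnS.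
(* The last factor is a difference of two [q k]-th powers, hence divisible by the difference of
   their bases, which is [v1]. *)
rewrite [X in _ X](_ : _ = (-1) ^+ k * 'C(c1, k)%:R * (x3 ^+ c3) ^+ (c1 - k)
   * x1 ^+ r k * x2 ^+ (k * a2)
   * ((x1 ^+ c1) ^+ q k - (x2 ^+ b2 * x3 ^+ a3) ^+ q k)).
  by rewrite subrXX; apply: idealM => //; apply: idealMr.
have x1E : (x1 ^+ b1) ^+ k = x1 ^+ r k * (x1 ^+ c1) ^+ q k.
  by rewrite -!exprM -exprD (addnC (r k)) (mulnC c1) -divn_eq mulnC.
have x3E : x3 ^+ (b1 * a3) * x3 ^+ e3 k =
    (x3 ^+ c3) ^+ (c1 - k) * (x3 ^+ a3) ^+ q k.
  rewrite -!exprM -!exprD (addnC (b1 * a3)%N) hn_x3_exponentE //.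
  by rewrite (mulnC c3) (mulnC a3).
have -> : x3 ^+ (b1 * a3) * ((-1) ^+ k * 'C(c1, k)%:R * hn_monomial k) =
  (-1) ^+ k * 'C(c1, k)%:R * x1 ^+ r k * x2 ^+ (k * a2 + q k * b2) *
  (x3 ^+ (b1 * a3) * x3 ^+ e3 k) by rewrite /hn_monomial; ring.
rewrite x3E !exprMn x1E -mulr_natr (exprD x2).
by rewrite [(k * a2)%N]mulnC [(q k * b2)%N]mulnC !exprM; ring.
Qed.

(* The last monomial of g is a pure power of x2; the others are divisible by
   x3, because b3 > 0. *)
Lemma hn_x2_exp_mem (J : set A) y :
  is_ideal J -> J (x3 * y) -> J (g * y) -> exists n, J (x2 ^+ n * y).
Proof.
move=> idJ Jx3y; rewrite hn_gE big_ord_recr /= mulrDl => Jgy.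
have Jsum : J ((\sum_(k < c1) (-1) ^+ k * 'C(c1, k)%:R * hn_monomial k) * y).
  rewrite mulr_suml; apply: ideal_sum => // k _.
  (* Indeed [e3 k] is (c1 - k) b3 + (c1 - k + q - b1) a3 with q = [q k]; the first term is positive
     and the second nonnegative. *)
  have [e e3k] : exists e, e3 k = e.+1.
    have := hn_x3_exponentE (ltnW (ltn_ord k)).
    have := hn_quotient_ge (ltnW (ltn_ord k)); have := ltn_ord k.
    by case: (e3 k) => [|e]; [nia | exists e].
  rewrite /hn_monomial e3k exprS.
  rewrite [X in J X](_ : _ = (-1) ^+ k * 'C(c1, k)%:R * x1 ^+ r k *
    x2 ^+ (k * a2 + q k * b2) * x3 ^+ e * (x3 * y)); last by ring.
  exact: idealM.
have c1_gt0 : (0 < c1)%N by rewrite addn_gt0 a1_gt0.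
(* At k = c1 the quotient is b1 and the remainder 0, so the exponents of [x1] and [x3] vanish. *)
have last_e : hn_monomial c1 = x2 ^+ (c1 * a2 + b1 * b2).
  rewrite /hn_monomial modnMr mulKn // subnn mul0n add0n subnn.
  by rewrite !expr0 mul1r mulr1.
exists (c1 * a2 + b1 * b2)%N; move: (idealB idJ Jgy Jsum).
rewrite addrC addKr last_e binn mulr1 => /(idealM ((-1) ^+ c1) idJ).
by rewrite !mulrA -exprD addnn -signr_odd odd_double expr0 mul1r.
Qed.

(** * Equality of the radicals *)

Lemma hn_radical_eq :
  radical (hn_ideal x1 x2 x3 a1 a2 a3 b1 b2 b3) =
  radical (ideal_gen [:: v1; g]).
Proof.
set I := hn_ideal _ _ _ _ _ _ _ _ _.
have idI : is_ideal I by apply: ideal_gen_ideal.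
have idK := ideal_gen_ideal [:: v1; g].
have idJ := radical_ideal idK; set J := radical (ideal_gen _) in idJ *.
have Jv1 : J v1 by apply/sub_radical/mem_ideal_gen; rewrite !inE eqxx.
have Jg : J g by apply/sub_radical/mem_ideal_gen; rewrite !inE eqxx orbT.
have JD : J D.
  apply: (@radical_exp _ _ c1); have [w ->] := hn_D_expE.
  by apply: idealD => //; apply: idealM.
have Jx1v2 : J (x1 * v2).
  apply: (@radical_expM _ _ b1) => //.
  (* Syzygy from the second row of the matrix. *)
  rewrite [X in _ X](_ : _ = - (x2 ^+ b2) * D - x3 ^+ b3 * v1).
    by apply: idealB => //; apply: idealM.
  by rewrite /hn_v1 /hn_v2 /hn_D !exprD; ring.
have Jx3v2 : J (x3 * v2).
  apply: (@radical_expM _ _ a3) => //.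
  (* Syzygy from the first row. *)
  rewrite [X in _ X](_ : _ = - (x1 ^+ a1) * D - x2 ^+ a2 * v1).
    by apply: idealB => //; apply: idealM.
  by rewrite /hn_v1 /hn_v2 /hn_D !exprD; ring.
have Jx2v2 : J (x2 * v2).
  have [n] := hn_x2_exp_mem idJ Jx3v2 (idealMr v2 idJ Jg).
  exact: radical_expM.
have Jv2 : J v2.
  (* Since a1 and a2 are positive, [v2] lies in the ideal generated by [x1] and [x2], so its square
     is a combination of [x1 * v2] and [x2 * v2]. *)
  have v2E : v2 = x2 ^+ (a2.-1 + b2) * x2 - x1 ^+ a1.-1 * x3 ^+ b3 * x1.
    by rewrite mulrAC -!exprSr -addSn !prednK.
  apply: (@radical_exp _ _ 2); rewrite expr2 {1}v2E mulrBl -!(mulrA _ _ v2).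
  by apply: idealB => //; apply: idealM.
apply/seteqP; split; apply: radical_sub.
  apply: ideal_gen_sub => // x; rewrite !inE.
  by move=> /or3P[] /eqP ->.
apply: subset_trans (@sub_radical _ I); apply: ideal_gen_sub => // x.
rewrite !inE => /orP[] /eqP ->.
  by apply: mem_ideal_gen; rewrite !inE eqxx.
by apply: hn_g_mem => //; apply: mem_ideal_gen; rewrite !inE eqxx ?orbT.
Qed.

End HerzogNorthcott.

Theorem theorem3p1 (A : comNzRingType) (x1 x2 x3 : A)
    (a1 a2 a3 b1 b2 b3 : nat)
    (A_noetherian : noetherian A)
    (x_proper : ~ ideal_gen [:: x1; x2; x3] 1)
    (x_height : has_height (ideal_gen [:: x1; x2; x3]) 3)
    (a_pos : [/\ (0 < a1)%N, (0 < a2)%N & (0 < a3)%N])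
    (b_pos : [/\ (0 < b1)%N, (0 < b2)%N & (0 < b3)%N]) :
  let v1 := hn_v1 x1 x2 x3 a1 a3 b1 b2 in
  let v2 := hn_v2 x1 x2 x3 a1 a2 b2 b3 in
  let I := hn_ideal x1 x2 x3 a1 a2 a3 b1 b2 b3 in
  exists g : A,
    [/\ g = hn_g x1 x2 x3 a1 a2 a3 b1 b2 b3,
        radical I g,
        radical I = radical (ideal_gen [:: v1; g])
      & regular_seq [:: x1; x2; x3] -> has_grade (ideal_gen [:: v1; v2]) 2 ->
        I g].
Proof.
move: a_pos b_pos => [a1_gt0 a2_gt0 _] [_ _ b3_gt0] v1 v2 I.
have Ig : I (hn_g x1 x2 x3 a1 a2 a3 b1 b2 b3).
  by apply: hn_g_mem => //; first exact: ideal_gen_ideal;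
    apply: mem_ideal_gen; rewrite !inE eqxx ?orbT.
exists (hn_g x1 x2 x3 a1 a2 a3 b1 b2 b3); split => //.
  exact: sub_radical.
exact: hn_radical_eq.
Qed.
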